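(* Let $A$ be a preorder. The preorder $Flat_{\mathcal{P}_1}(A)$ of non-empty downsets of $A$, together with the order-preserving map $i_A:A\to Flat_{\mathcal{P}_1}(A)$ sending $a$ to the downset generated by $a$, is such that for any preorder $B$ having least upper bounds of all non-empty subsets and any order-preserving map $f:A\to B$, there is a unique map $\bar f: Flat_{\mathcal{P}_1}(A)\to B$ preserving least upper bounds of non-empty sets and satisfying $\bar f\circ i_A = f$.
   Context: $Flat_{\mathcal{P}_1}(A)$ denotes, as a preorder, the set of non-empty downward closed subsets (downsets) of $A$ ordered by inclusion; the downset generated by $a$ is $\{x\in A\mid x\le a\}$.
   Formalization: Since B is only a preorder, the equation f̄∘i_A = f and the uniqueness of f̄ are stated up to pointwise equivalence (x ≤ y and y ≤ x) instead of strict equality, which can fail; when B is a partial order this is strict equality. *)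

(* Defs.v *)
From HB Require Import structures.
From mathcomp Require Import all_boot all_order.
From mathcomp Require Import boolp classical_sets.

Set Implicit Arguments.
Unset Strict Implicit.
Unset Printing Implicit Defensive.

Import Order.Theory.
Local Open Scope classical_set_scope.
Local Open Scope order_scope.

(* The library's [ubound], [isLub] and [supremums] require a partial order.
   In a preorder a least upper bound is only unique up to equivalence, so it is
   a relation between a subset and an element. *)
Section Preorders.
Context {d : Order.disp_t} {T : preorderType d}.
Implicit Types (S : set T) (x y s u : T).

Definition is_lub S s : Prop :=
  (forall x, S x -> x <= s) /\
  (forall u, (forall x, S x -> x <= u) -> s <= u).

Definition preord_equiv x y : bool := x <= y <= x.

Definition down_closed S : Prop := forall x y, x <= y -> S y -> S x.

Definition principal_downset x : set T := [set y | y <= x].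

End Preorders.

Definition has_nonempty_lubs d (T : preorderType d) : Prop :=
  forall S : set T, S !=set0 -> exists s, is_lub S s.

Definition preserves_nonempty_lubs d (T : preorderType d)
    d' (T' : preorderType d') (f : T -> T') : Prop :=
  forall (S : set T) (s : T), S !=set0 -> is_lub S s -> is_lub (f @` S) (f s).

(* Equality of maps into a preorder: pointwise equivalence, i.e. isomorphism for
   the pointwise preorder on maps. Leibniz equality is not available here:
   equivalent elements of the source of [flat_unit] generate the same downset,
   but an order-preserving map may send them to distinct equivalent elements. *)
Definition map_equiv X d (T : preorderType d) (f g : X -> T) : Prop :=
  forall x, preord_equiv (f x) (g x).

Section Flat.
Context {d : Order.disp_t} (A : preorderType d).

Record flat : Type := Flat {
  flat_set :> set A;
  flat_nonempty : flat_set !=set0;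
  flat_down_closed : down_closed flat_set
}.

HB.instance Definition _ := gen_eqMixin flat.
HB.instance Definition _ := gen_choiceMixin flat.

Definition flat_le (D E : flat) : bool := `[< D `<=` E >].

Lemma flat_le_refl : reflexive flat_le.
Proof. by move=> D; apply/asboolP. Qed.

Lemma flat_le_trans : transitive flat_le.
Proof.
by move=> E D F /asboolP DE /asboolP EF; apply/asboolP; exact: subset_trans EF.
Qed.

HB.instance Definition _ :=
  Order.Le_isPreorder.Build set_display flat flat_le_refl flat_le_trans.

Lemma principal_downset_nonempty (a : A) : principal_downset a !=set0.
Proof. by exists a; exact: lexx. Qed.

Lemma principal_downset_down_closed (a : A) :
  down_closed (principal_downset a).
Proof. by move=> x y xy ya; exact: le_trans xy ya. Qed.

Definition flat_unit (a : A) : flat :=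
  Flat (principal_downset_nonempty a) (@principal_downset_down_closed a).

End Flat.

(* Main.v *)
(* A non-empty downset D is the least upper bound of the principal downsets of
   its elements, and least upper bounds of families of downsets are unions.
   The extension of f must therefore send D to a least upper bound of f(D), and
   this choice preserves least upper bounds because those of unions are
   computed piecewise. *)
Require Import Defs.
From mathcomp Require Import all_boot all_order.
From mathcomp Require Import boolp classical_sets.

Import Order.Theory.
Local Open Scope classical_set_scope.
Local Open Scope order_scope.

Lemma is_lub_equiv (d : Order.disp_t) (T : preorderType d) (S S' : set T)
    (s s' : T) :
  (forall x, S x -> exists2 y, S' y & x <= y) ->
  (forall y, S' y -> exists2 x, S x & y <= x) ->
  is_lub S s -> is_lub S' s' -> preord_equiv s s'.
Proof.
move=> SS' S'S [ubs lubs] [ubs' lubs']; apply/andP; split.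
- by apply: lubs => x /SS'[y S'y xy]; exact: le_trans xy (ubs' _ S'y).
- by apply: lubs' => y /S'S[x Sx yx]; exact: le_trans yx (ubs _ Sx).
Qed.

Section FlatLubs.
Context {dA : Order.disp_t} {A : preorderType dA}.
Implicit Types (D E : flat A) (S : set (flat A)).

Lemma flat_leP D E : reflect (D `<=` E) (D <= E).
Proof. exact: asboolP. Qed.

Lemma flat_unit_homo : {homo @flat_unit dA A : x y / x <= y}.
Proof. by move=> x y xy; apply/flat_leP => z zx; exact: le_trans zx xy. Qed.

Lemma is_lub_flat_unit D : is_lub (@flat_unit dA A @` D) D.
Proof.
split=> [_ [a Da <-]|E ubE]; apply/flat_leP => x.
- by move=> xa; exact: flat_down_closed xa Da.
- move=> Dx; have /flat_leP := ubE _ (imageP _ Dx); apply.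
  exact: lexx.
Qed.

Lemma flat_lub_sub_bigcup S D :
  S !=set0 -> is_lub S D -> D `<=` \bigcup_(E in S) E.
Proof.
move=> [E0 SE0] [_ lubD].
have U0 : \bigcup_(E in S) (E : set A) !=set0.
  by have [x E0x] := flat_nonempty E0; exists x, E0.
have Ud : down_closed (\bigcup_(E in S) (E : set A)).
  by move=> x y xy [E SE Ey]; exists E => //; exact: flat_down_closed xy Ey.
apply/(flat_leP D (Flat U0 Ud))/lubD => E SE.
by apply/flat_leP => x Ex; exists E.
Qed.

End FlatLubs.

Theorem theorem4p2 (dA : Order.disp_t) (A : preorderType dA) :
  {homo @flat_unit dA A : x y / (x <= y)%O} /\
  forall (dB : Order.disp_t) (B : preorderType dB) (f : A -> B),
    has_nonempty_lubs B ->
    {homo f : x y / (x <= y)%O} ->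
    exists fbar : flat A -> B,
      [/\ preserves_nonempty_lubs fbar,
          map_equiv (fbar \o @flat_unit dA A) f
        & forall g : flat A -> B,
            preserves_nonempty_lubs g ->
            map_equiv (g \o @flat_unit dA A) f ->
            map_equiv g fbar].
Proof.
split=> [|dB B f lubsB f_homo]; first exact: flat_unit_homo.
have /choice[fbar fbar_lub] (D : flat A) : exists b, is_lub (f @` D) b.
  by apply: lubsB; have [x Dx] := flat_nonempty D; exists (f x), x.
have f_le (D : flat A) x : flat_set D x -> f x <= fbar D.
  by move=> Dx; apply: (fbar_lub D).1; exists x.
exists fbar; split.
- move=> S D S0 lubD; split=> [_ [E SE <-]|u ubu].
    apply: (fbar_lub E).2 => _ [x Ex <-]; apply: f_le.
    by have /flat_leP := lubD.1 _ SE; apply.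
  apply: (fbar_lub D).2 => _ [x Dx <-].
  have [E SE Ex] := flat_lub_sub_bigcup _ _ S0 lubD _ Dx.
  by apply: le_trans (f_le _ _ Ex) (ubu _ _); exists E.
- move=> a; apply/andP; split; last by apply: f_le; exact: lexx.
  by apply: (fbar_lub _).2 => _ [x xa <-]; exact: f_homo.
- move=> g g_lub g_unit D.
  have D0 : @flat_unit dA A @` D !=set0.
    by have [x Dx] := flat_nonempty D; exists (flat_unit x), x.
  apply: is_lub_equiv (g_lub _ _ D0 (is_lub_flat_unit D)) (fbar_lub D).
    move=> _ [_ [a Da <-] <-]; exists (f a); first by exists a.
    by have /andP[] := g_unit a.
  move=> _ [a Da <-]; exists (g (flat_unit a)).
    by exists (flat_unit a) => //; exists a.
  by have /andP[] := g_unit a.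
Qed.
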